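(* Let $\{(\mathfrak{M}_k,\Theta_k)\}_{k\in\mathbb{Z}}$ be a tight $g$-fusion frame for $H$ such that, for every $k\in\mathbb{Z}$, $\Theta_k$ is self-adjoint and $\Theta_k(\mathfrak{M}_k)=\mathfrak{M}_k$. Then $\{\Theta_k\}_{k\in\mathbb{Z}}$ is not represented via an invertible linear operator $T$ on $\operatorname{span}\{\mathfrak{M}_k\}_{k\in\mathbb{Z}}$.
   Context: $H$ is an infinite-dimensional separable Hilbert space and $\mathcal{L}(H)$ is the space of bounded linear operators on $H$. $\{\mathfrak{M}_k\}_{k\in\mathbb{Z}}$ is a sequence of closed subspaces of $H$, and $\operatorname{span}\{\mathfrak{M}_k\}_{k\in\mathbb{Z}}$ is the (algebraic) linear span of their union. $\{\Theta_k\}_{k\in\mathbb{Z}}$ is a sequence in $\mathcal{L}(H)$ such that the range of $\Theta_k$ is contained in $\mathfrak{M}_k$ for every $k\in\mathbb{Z}$. $\{(\mathfrak{M}_k,\Theta_k)\}_{k\in\mathbb{Z}}$ is a $g$-fusion frame with frame bounds $A,B$ if $0<A\le B<\infty$ and $A\|f\|^2\le\sum_{k\in\mathbb{Z}}\|\Theta_k(f)\|^2\le B\|f\|^2$ for every $f\in H$; it is tight if this holds with $A=B$. $\{\Theta_k\}_{k\in\mathbb{Z}}$ is represented via a linear operator $T$ on $\operatorname{span}\{\mathfrak{M}_k\}_{k\in\mathbb{Z}}$ (a linear map, not assumed bounded) if $\Theta_{k+1}=T\Theta_k$ for all $k\in\mathbb{Z}$. *)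

(* Defs.v *)
From HB Require Import structures.
From mathcomp Require Import all_boot all_order all_algebra.
From mathcomp Require Import all_classical all_reals all_analysis.
From mathcomp Require Import sesquilinear complex.

Set Implicit Arguments.
Unset Strict Implicit.
Unset Printing Implicit Defensive.

Import Order.TTheory GRing.Theory Num.Theory.
Import numFieldNormedType.Exports.

Local Open Scope classical_set_scope.
Local Open Scope ring_scope.

(* A Hilbert space is over the real or over the complex numbers. *)
Variant scalar_kind := RealScalars | ComplexScalars.

Definition scalar_field (R : realType) (F : scalar_kind) : numFieldType :=
  match F with RealScalars => R | ComplexScalars => R[i] end.

Definition scalar_conj (R : realType) (F : scalar_kind) :
    {rmorphism scalar_field R F -> scalar_field R F} :=
  match F with RealScalars => idfun | ComplexScalars => Num.conj end.

Definition scalar_re (R : realType) (F : scalar_kind) : scalar_field R F -> R :=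
  match F with RealScalars => idfun | ComplexScalars => @complex.Re R end.

(* The inner product is linear in its first argument and conjugate-linear in
   its second one. *)
Record hilbertSpace (R : realType) (F : scalar_kind) := HilbertSpace {
  hilbert_sort :> completeNormedModType (scalar_field R F);
  inner : {dot hilbert_sort for scalar_conj R F};
  inner_normE : forall x : hilbert_sort, inner x x = `|x| ^+ 2
}.

Arguments inner {R F h}.

Section hilbert.
Context {R : realType} {F : scalar_kind} {H : hilbertSpace R F}.
Implicit Types (A V : set H) (M : int -> set H) (Theta : int -> {linear H -> H}).

(* The norm of the library takes its values in the scalar field. *)
Definition hnorm (x : H) : R := scalar_re `|x|.

(* The algebraic span: finite linear combinations of elements of A. *)
Definition linear_span A : set H :=
  [set x | exists (n : nat) (a : 'I_n -> scalar_field R F) (v : 'I_n -> H),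
     (forall i, A (v i)) /\ x = \sum_i a i *: v i].

Definition closed_subspace V : Prop := submod_closed [in V] /\ closed V.

Definition bounded_operator (T : H -> H) : Prop :=
  exists c : R, forall x, hnorm (T x) <= c * hnorm x.

Definition is_adjoint (T S : H -> H) : Prop :=
  forall x y, inner (T x) y = inner x (S y).

Definition self_adjoint (T : H -> H) : Prop := is_adjoint T T.

Definition gfusion_system M Theta : Prop :=
  forall k, [/\ closed_subspace (M k), bounded_operator (Theta k)
              & range (Theta k) `<=` M k].

Definition gfusion_frame M Theta (A B : R) : Prop :=
  [/\ gfusion_system M Theta, 0 < A, A <= B &
   forall f : H,
     ((A * hnorm f ^+ 2)%:E
        <= \esum_(k in [set: int]) (hnorm (Theta k f) ^+ 2)%:E)%E /\
     (\esum_(k in [set: int]) (hnorm (Theta k f) ^+ 2)%:E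
        <= (B * hnorm f ^+ 2)%:E)%E].

Definition tight_gfusion_frame M Theta : Prop :=
  exists A : R, gfusion_frame M Theta A A.

(* Linear operators on a subspace V are total functions on H of which only the
   restriction to V matters. *)
Definition linear_operator_on V (T : H -> H) : Prop :=
  set_fun V V T /\
  forall (a : scalar_field R F) (x y : H), V x -> V y ->
    T (a *: x + y) = a *: T x + T y.

Definition invertible_on V (T : H -> H) : Prop := set_bij V V T.

Definition span_family M : set H := linear_span (\bigcup_k M k).

Definition represented_via M Theta (T : H -> H) : Prop :=
  linear_operator_on (span_family M) T /\
  forall (k : int) (f : H), Theta (k + 1) f = T (Theta k f).

End hilbert.

Definition infinite_dimensional (R : realType) (F : scalar_kind)
    (H : hilbertSpace R F) : Prop :=
  forall A : set H, finite_set A -> linear_span A <> [set: H].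

Definition separable (R : realType) (F : scalar_kind)
    (H : hilbertSpace R F) : Prop :=
  exists D : set H, countable D /\ dense D.

(* Main.v *)
Require Import Defs.
From mathcomp Require Import all_boot all_order all_algebra.
From mathcomp Require Import all_classical all_reals all_analysis.
From mathcomp Require Import sesquilinear complex.

(** Let the tight frame have bound [A], and suppose [Theta (k + 1) = T Theta k]
    with [T] injective on the span.

    Any relation [Theta (k + 1) y = Theta k x] holds for all [k] as soon as it
    holds for one: [T] moves it up and injectivity of [T] moves it down
    ([represented_eq_shift]).  In the same way the kernels of the [Theta k]
    coincide; the lower frame bound makes the common kernel trivial, and then
    [Theta k (M k) = M k] with [range (Theta k)] inside [M k] forces every
    [M k] to be [H].  Hence all the [Theta k] are bijections of [H].

    For [x] in [H] let [y] be the solution of [Theta 1 y = Theta 0 x].  The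
    frame sums of [x] and [y] are shifts of each other, so tightness gives
    [|y| = |x|] ([tight_frame_isometry]): the map [y |-> x], which is
    [Theta 0 ^-1 T Theta 0], is unitary.  Self-adjointness identifies this
    unitary with the adjoint of [T], so [T] is unitary too.  This enters as the
    inequality [|Theta k w| <= |Theta (k + 1) w|], which comes out of
    positivity of the inner product ([represented_norm_nondecreasing]).
    For [w != 0] the terms [|Theta k w| ^+ 2] with [k >= 0] are thus bounded
    below by the positive number [|Theta 0 w| ^+ 2], and the frame sum of [w]
    is infinite, against the upper frame bound. *)

Local Open Scope classical_set_scope.
Local Open Scope ring_scope.

Import Order.TTheory GRing.Theory Num.Theory.
Import numFieldNormedType.Exports.

(** * Sums and induction over the integers *)

Lemma int_iff_shift (P : int -> Prop) (j k : int) :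
  (forall i, P i <-> P (i + 1)) -> P j -> P k.
Proof.
move=> Pshift Pj; rewrite -(subrK j k) addrC.
elim: (k - j) => [|n IHn|n IHn]; first by rewrite addr0.
- by rewrite intS (addrC 1) addrA; apply: (Pshift _).1.
- by apply: (Pshift _).2; rewrite intS opprD addrA addrAC subrK.
Qed.

Lemma esum_int_shift (R : realType) (a : int -> \bar R) :
  \esum_(k in [set: int]) a (k + 1) = \esum_(k in [set: int]) a k.
Proof.
rewrite [RHS](@reindex_esum _ _ _ setT setT (fun k : int => k + 1)) //.
by rewrite setTT_bijective; exists (fun k => k - 1) => k; rewrite ?addrK ?subrK.
Qed.

Lemma esum_infty_of_inj_ge (R : realType) (I : choiceType) (a : I -> R)
    (e : nat -> I) (c : R) :
    injective e -> 0 < c -> (forall n, c <= a (e n)) ->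
  \esum_(i in [set: I]) (a i)%:E = +oo%E.
Proof.
move=> e_inj c_gt0 le_ca; apply: eq_infty => r.
pose n := (Num.truncn (r / c)).+1.
apply: esum_ge; exists (e @` `I_n).
  by split => //; apply: finite_image; exact: finite_II.
rewrite fsbig_image; last by move=> i j _ _ /e_inj.
rewrite -fsbig_ord sumEFin lee_fin.
have le_rn : r <= \sum_(i < n) c.
  rewrite sumr_const card_ord -mulr_natl -ler_pdivrMr //.
  exact/ltW/truncnS_gt.
by apply: le_trans le_rn _; apply: ler_sum.
Qed.

(** * The real norm of a Hilbert space *)

(** Nonnegative complex scalars are real, so their order is that of their real
    parts. *)
Lemma scalar_re_le (R : realType) (F : scalar_kind) (a b : scalar_field R F) :
  0 <= a -> 0 <= b -> (scalar_re a <= scalar_re b) = (a <= b).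
Proof.
case: F a b => //= a b; rewrite !lecE => /andP[/eqP-> _] /andP[/eqP-> _].
by rewrite eqxx.
Qed.

Section HilbertNorm.
Context {R : realType} {F : scalar_kind} {H : hilbertSpace R F}.
Implicit Types x y : H.

Lemma hnorm_le x y : (hnorm x <= hnorm y) = (inner x x <= inner y y).
Proof. by rewrite scalar_re_le // !inner_normE ler_sqr // nnegrE. Qed.

Lemma scalar_re0 : scalar_re (0 : scalar_field R F) = 0.
Proof. by case: F. Qed.

Lemma hnorm_ge0 x : 0 <= hnorm x.
Proof. by rewrite -scalar_re0 scalar_re_le. Qed.

Lemma hnorm_gt0 x : x != 0 -> 0 < hnorm x.
Proof. by move=> x0; rewrite ltNge -scalar_re0 scalar_re_le // normr_le0. Qed.

Lemma inner_eq_hnorm x y : hnorm x = hnorm y -> inner x x = inner y y.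
Proof.
by move=> xy; apply/eqP; rewrite eq_le -!hnorm_le xy lexx.
Qed.

Lemma infinite_dimensional_neq0 :
  infinite_dimensional H -> exists x : H, x != 0.
Proof.
move=> Hinf; apply: contrapT => noH.
apply: (Hinf set0 (finite_set0 _)); apply/seteqP; split=> // x _.
exists 0%N, (fun=> 0), (fun=> 0); split=> [[]//|]; rewrite big_ord0.
by apply/eqP; apply: contrapT => /negP x0; apply: noH; exists x.
Qed.

End HilbertNorm.

(** * Systems represented via an invertible operator *)

Section Represented.
Set Implicit Arguments.
Unset Strict Implicit.
Context {R : realType} {F : scalar_kind} {H : hilbertSpace R F}.
Context {M : int -> set H} {Theta : int -> {linear H -> H}}.
Implicit Types x y w : H.

Lemma sub_span_family k x : M k x -> span_family M x.
Proof.
move=> Mx; exists 1%N, (fun=> 1), (fun=> x).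
by split=> [i|]; [exists k|rewrite big_ord1 scale1r].
Qed.

(** Both sides of [Theta (k + i) y = Theta k x] are moved from [k] to [k + 1]
    by [T], and back by its injectivity: [i = 0] compares two vectors along
    the system, [i = 1] compares a vector with a shifted one. *)
Lemma represented_eq_shift (T : H -> H) (i j k : int) x y :
    (forall l, range (Theta l) `<=` M l) ->
    represented_via M Theta T -> invertible_on (span_family M) T ->
  Theta (j + i) y = Theta j x -> Theta (k + i) y = Theta k x.
Proof.
move=> ThetaM [_ ThetaT] [_ T_inj _].
apply: (@int_iff_shift (fun k => Theta (k + i) y = Theta k x)) => l.
rewrite addrAC !ThetaT; split=> [->//|]; apply: T_inj.
- by rewrite inE; apply: (@sub_span_family (l + i)); apply: ThetaM; exists y.
- by rewrite inE; apply: (@sub_span_family l); apply: ThetaM; exists x.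
Qed.

(** Two vectors identified by one [Theta k] are identified by all of them, so
    every term of the frame sum of their difference vanishes. *)
Lemma represented_inj (T : H -> H) (A B : R) k x y :
    gfusion_frame M Theta A B ->
    represented_via M Theta T -> invertible_on (span_family M) T ->
  Theta k x = Theta k y -> x = y.
Proof.
move=> [sysM A_gt0 _ frame] repT invT Txy.
have ThetaM l : range (Theta l) `<=` M l by have [] := sysM l.
have Txy0 l : Theta l (x - y) = 0.
  have := represented_eq_shift (i := 0) (j := k) l (y := x) (x := y)
    ThetaM repT invT.
  by rewrite !addr0 linearB => /(_ Txy) ->; rewrite subrr.
have [+ _] := frame (x - y); rewrite esum1; last first.
  by move=> l _; rewrite Txy0 /hnorm normr0 scalar_re0 expr0n.
apply: contraPP => /eqP; rewrite -subr_eq0 => /hnorm_gt0 xy.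
by apply/negP; rewrite -ltNge lte_fin mulr_gt0 // exprn_gt0.
Qed.

(** Injectivity of [Theta k] turns [Theta k (M k) = M k] into [M k = H]:
    any [z] has the same image as some element of [M k], hence is in [M k]. *)
Lemma represented_surj (T : H -> H) (A B : R) k y :
    gfusion_frame M Theta A B -> Theta k @` M k = M k ->
    represented_via M Theta T -> invertible_on (span_family M) T ->
  exists x, Theta k x = y.
Proof.
move=> frame Mk repT invT.
have [sysM _ _ _] := frame.
suff : M k y by rewrite -Mk => -[x _ <-]; exists x.
have : (Theta k @` M k) (Theta k y).
  by have [_ _] := sysM k; rewrite Mk; apply; exists y.
by move=> [x Mx /(represented_inj frame repT invT) <-].
Qed.

(** The frame sums of [x] and [y] differ by a shift of the index, and a tight
    frame sum determines the norm. *)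
Lemma tight_frame_isometry (A : R) x y :
    gfusion_frame M Theta A A ->
  (forall k, Theta (k + 1) y = Theta k x) -> hnorm y = hnorm x.
Proof.
move=> [_ A_gt0 _ frame] yx.
have sumE z : (\esum_(k in [set: int]) (hnorm (Theta k z) ^+ 2)%:E =
    (A * hnorm z ^+ 2)%:E)%E.
  by apply/eqP; rewrite eq_le; have [-> ->] := frame z.
have /eqP : ((A * hnorm y ^+ 2)%:E = (A * hnorm x ^+ 2)%:E)%E.
  by rewrite -!sumE -esum_int_shift; apply: eq_esum => k _; rewrite yx.
rewrite eqe (inj_eq (mulfI (lt0r_neq0 A_gt0))).
by rewrite eqrXn2 ?hnorm_ge0 // => /eqP.
Qed.

(** Put [x = Theta k w], [v = Theta (k + 1) w], and let [y] be the vector of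
    the same norm as [x] with [Theta (k + 1) y = Theta k x].  Self-adjointness
    of both operators gives [<v, y> = <y, v> = <x, x> = <y, y>], so
    [0 <= <v - y, v - y> = <v, v> - <x, x>]. *)
Lemma represented_norm_nondecreasing (T : H -> H) (A : R) k w :
    gfusion_frame M Theta A A -> (forall l, self_adjoint (Theta l)) ->
    (forall l, Theta l @` M l = M l) ->
    represented_via M Theta T -> invertible_on (span_family M) T ->
  hnorm (Theta k w) <= hnorm (Theta (k + 1) w).
Proof.
move=> frame sa MM repT invT.
have ThetaM l : range (Theta l) `<=` M l by case: frame => /(_ l) [].
set x := Theta k w; set v := Theta (k + 1) w.
have [y yx] := represented_surj (Theta k x) frame (MM (k + 1)) repT invT.
have yxE : inner y y = inner x x.
  apply/inner_eq_hnorm/(tight_frame_isometry frame) => l.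
  exact: (represented_eq_shift l ThetaM repT invT yx).
have yvE : inner y v = inner x x by rewrite -sa yx sa.
have vyE : inner v y = inner x x by rewrite sa yx -sa.
have : 0 <= inner (v - y) (v - y) by rewrite inner_normE exprn_ge0.
by rewrite linearBl !linearBr /= yxE yvE vyE subrr subr0 hnorm_le subr_ge0.
Qed.

End Represented.

Theorem theorem3p3 (R : realType) (F : scalar_kind) (H : hilbertSpace R F)
    (Hinf : infinite_dimensional H) (Hsep : separable H)
    (M : int -> set H) (Theta : int -> {linear H -> H})
    (Hframe : tight_gfusion_frame M Theta)
    (Hsa : forall k, self_adjoint (Theta k))
    (Hrange : forall k, Theta k @` M k = M k) :
  ~ exists T : H -> H,
      represented_via M Theta T /\ invertible_on (span_family M) T.
Proof.
move=> [T [repT invT]]; have [A frame] := Hframe.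
have [w w_neq0] := infinite_dimensional_neq0 Hinf.
have Tw_gt0 : 0 < hnorm (Theta 0 w).
  apply: hnorm_gt0; apply: contra_neq w_neq0 => Tw0.
  by apply: (represented_inj frame repT invT (k := 0)); rewrite Tw0 linear0.
have le_Tw (n : nat) : hnorm (Theta 0 w) <= hnorm (Theta n w).
  elim: n => // n /le_trans; apply; rewrite intS addrC.
  exact: (represented_norm_nondecreasing n w frame Hsa Hrange repT invT).
have [_ _ _ /(_ w) [_]] := frame.
rewrite (@esum_infty_of_inj_ge _ _ _ Posz (hnorm (Theta 0 w) ^+ 2)) //.
- by move=> m n [].
- exact: exprn_gt0.
- by move=> n; rewrite lerXn2r ?nnegrE ?hnorm_ge0.
Qed.
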